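(* Let $n,m_1,\dots,m_n$ be positive integers and $M=m_1+\dots+m_n$. Let $f_j\neq 0$ ($j=1,\dots,n$) and $c_{js}$ ($1\le j\le n$, $0\le s\le m_j-1$) be complex or real parameters, let $z_j=e^{f_j}$, and put $$h(k)=\sum_{j=1}^{n}\sum_{s=0}^{m_j-1}c_{js}\,k^s z_j^k,\qquad 0^0\equiv 1.$$ Let $k_0\ge 0$ and $N\ge M$ be integers, and let $2N$ sampled data $h(k)$, $k=k_0,k_0+1,\dots,k_0+2N-1$, be given. Assume that $M$ is known and that the sampled data are noiseless (i.e. they are exactly the values $h(k)$ given by the formula above). Then: (a) the Hankel matrices $\mathbf{H}_{NN}^{k_0}$ and $\mathbf{H}_{NN}^{k_0+1}$ have rank $M$, that is, $\operatorname{rank}\mathbf{H}_{NN}^{k_0}=\operatorname{rank}\mathbf{H}_{NN}^{k_0+1}=M$; (b) $\mathbf{H}_{NM}^{k_0+1}=\mathbf{H}_{NM}^{k_0}\,\mathbf{C}_M(P)$, where $\mathbf{C}_M(P)$ is the companion matrix of the Prony polynomial $P$.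
   Context: For $\kappa\in\{k_0,k_0+1\}$, $\mathbf{H}_{NN}^{\kappa}$ denotes the square Hankel matrix of order $N$ whose $(i,l)$ entry is $h(\kappa+i+l-2)$, $1\le i,l\le N$, and $\mathbf{H}_{NM}^{\kappa}$ denotes the $N\times M$ matrix formed by the first $M$ columns of $\mathbf{H}_{NN}^{\kappa}$. The Prony polynomial is the monic polynomial of degree $M$ having $z_j$ as its $j$th zero with multiplicity $m_j$, that is, $P(z)=\prod_{j=1}^{n}(z-z_j)^{m_j}=\sum_{k=0}^{M}p_kz^k$, with $p_M=1$. Its companion matrix is the $M\times M$ matrix $$\mathbf{C}_M(P)=\begin{pmatrix}0&0&\dots&0&-p_0\\1&0&\dots&0&-p_1\\ \vdots&\vdots& &\vdots&\vdots\\0&0&\dots&1&-p_{M-1}\end{pmatrix},$$ i.e. with ones on the subdiagonal, last column $(-p_0,-p_1,\dots,-p_{M-1})^T$, and zeros elsewhere.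
   Formalization: Part (a) is stated under two added conditions, that the z_j are pairwise distinct and that c_{j,m_j-1} ≠ 0 for every j; without them (a) is false (e.g. all c_{js}=0 gives rank 0). Part (b) is unchanged. *)

(* Defs.v *)
From HB Require Import structures.
From mathcomp Require Import all_boot all_order all_algebra.
From mathcomp Require Import complex.
From mathcomp Require Import reals sequences exp trigo.

Set Implicit Arguments.
Unset Strict Implicit.
Unset Printing Implicit Defensive.

Import Order.TTheory GRing.Theory Num.Theory.
Local Open Scope ring_scope.

Definition cexp (R : realType) (w : R[i]) : R[i] :=
  Complex (expR (complex.Re w) * cos (complex.Im w))
          (expR (complex.Re w) * sin (complex.Im w)).

(* Only the values c j s with s < m j matter. The convention 0^0 = 1 is the
   one of the library: x ^+ 0 = 1 for every x. *)
Definition monomial_exp_sum (F : comNzRingType) (n : nat) (m : 'I_n -> nat)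
    (c : 'I_n -> nat -> F) (z : 'I_n -> F) (k : nat) : F :=
  \sum_(j < n) \sum_(s < m j) c j s * k%:R ^+ s * z j ^+ k.

(* Indices start at 0, whence h (k + i + l) for h (k + i + l - 2). *)
Definition hankel_mx (T : Type) (h : nat -> T) (k N : nat) : 'M[T]_N :=
  \matrix_(i < N, l < N) h (k + i + l)%N.

Definition hankel_cols (T : Type) (h : nat -> T) (k N M : nat)
    (leMN : (M <= N)%N) : 'M[T]_(N, M) :=
  colsub (widen_ord leMN) (hankel_mx h k N).

Definition prony_poly (F : comNzRingType) (n : nat) (m : 'I_n -> nat)
    (z : 'I_n -> F) : {poly F} :=
  \prod_(j < n) ('X - (z j)%:P) ^+ m j.

(* For monic p with size p = M.+1 this is the transpose of companionmx p from
   mxpoly, typed with the dimension M rather than (size p).-1. *)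
Definition companion_mx (F : nzRingType) (M : nat) (p : {poly F}) : 'M[F]_M :=
  \matrix_(i < M, l < M)
    if l.+1 == M then - p`_i else (i == l.+1 :> nat)%:R.

(* Main.v *)
Require Import Defs.
From HB Require Import structures.
From mathcomp Require Import all_boot all_order all_algebra.
From mathcomp Require Import complex ring zify.
From mathcomp Require Import reals sequences exp trigo.

Set Implicit Arguments.
Unset Strict Implicit.
Unset Printing Implicit Defensive.

Import Order.TTheory GRing.Theory Num.Theory.
Local Open Scope ring_scope.

(** For a polynomial q, let L(q) be obtained from q by replacing every 'X^k by
    the value g(k) of the exponential sum. Since the Euler operator
    theta = X d/dX satisfies theta^s 'X^k = k^s 'X^k, this functional is
    L(q) = sum_j sum_s c_js (theta^s q)(z_j) ([umbral], [umbral_Xn]): it only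
    sees q through its derivatives of order below m_j at z_j. Everything follows
    from the way theta acts on (X - z)^m: theta^s of a multiple of (X - z)^m
    vanishes at z for s < m ([iter_euler_multiple_root]), while for s = m it
    takes an explicit value there ([iter_euler_root]).

    In particular L kills every multiple of the Prony polynomial P ([umbral_prony]).
    Applied to 'X^k * P this is the linear recurrence of g with the coefficients
    of P, and that recurrence is the last column of the companion identity (b);
    the other columns only shift indices.

    For (a), a row vector v of length N is read as a polynomial q of degree less
    than N. The l-th entry of v times the Hankel matrix starting at k is then
    L(X^(k+l) q) ([mul_hankel_mx]), so v is in the left kernel when P divides q.
    The converse is where distinct nodes and nonzero leading coefficients enter
    ([dvdp_prony]): if P does not divide q, the order a of q at some z_j is less
    than m_j. With r = P / (X - z_j)^(a + 1), of degree less than M, the product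
    r q vanishes to order m_i at the other z_i and to order exactly m_j - 1 at
    z_j; the only surviving term of L(X^k r q) is the one of c_j(m_j - 1), and it
    is not zero. Hence the Hankel matrix has the left kernel of the map
    q |-> q mod P, which is onto the polynomials of degree less than M, so its
    rank is M ([rank_hankel_mx]). *)

(** * Preliminaries on ranks and divisibility *)

Lemma eq_mxrank_ker (F : fieldType) (m n p : nat)
    (A : 'M[F]_(m, n)) (B : 'M[F]_(m, p)) :
  (forall v : 'rV_m, v *m A = 0 <-> v *m B = 0) -> \rank A = \rank B.
Proof.
move=> eqAB; have eqker: (kermx A == kermx B)%MS.
  apply/andP; split; apply/rV_subP=> v /sub_kermxP/eqAB ?;
    exact/sub_kermxP.
have := congr1 (subn m) (eqmx_rank eqker).
by rewrite !mxrank_ker !subKn ?rank_leq_row.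
Qed.

Lemma dvdp_prod_coprime (R : idomainType) (I : finType)
    (p_ : I -> {poly R}) (q : {poly R}) :
  (forall i j, i != j -> coprimep (p_ i) (p_ j)) ->
  (forall i, p_ i %| q) -> \prod_i p_ i %| q.
Proof.
move=> co_p dvd_q; elim: (index_enum I) (index_enum_uniq I) => [|i s IHs] /=.
  by rewrite big_nil dvd1p.
case/andP=> s'i /IHs dvd_s; rewrite big_cons Gauss_dvdp ?dvd_q //.
rewrite big_seq; apply: (big_ind (coprimep (p_ i))) => [|p p'|k s_k].
- exact: coprimep1.
- by rewrite coprimepMr => -> ->.
- by apply: co_p; apply: contraNneq s'i => ->.
Qed.

(** * The Euler operator and multiple roots *)

Definition euler (R : comNzRingType) (q : {poly R}) : {poly R} := 'X * q^`().

Lemma iter_euler_is_linear (R : comNzRingType) (s : nat) :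
  linear (iter s (@euler R)).
Proof.
move=> a p q; elim: s => //= s ->.
by rewrite /euler linearP mulrDr -scalerAr.
Qed.

(** The powers of the variable are eigenvectors of the Euler operator; this is
    how the polynomial factors k^s of an exponential sum arise from derivatives
    at the nodes. *)
Lemma iter_euler_Xn (R : comNzRingType) (s k : nat) :
  iter s (@euler R) 'X^k = k%:R ^+ s *: 'X^k.
Proof.
elim: s => [|s /= ->]; first by rewrite expr0 scale1r.
rewrite /euler linearZ /= derivXn -scalerAr.
case: k => [|k]; first by rewrite !mulr0n mulr0 scaler0 expr0n scale0r.
by rewrite /= mulrnAr -exprS -scaler_nat scalerA -exprSr.
Qed.

(** One application of the Euler operator to (X - z)^(s+1) u gives (X - z)^s u'
    where u'(z) = (s + 1) z u(z), so the exponent can be removed one step at a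
    time. *)
Lemma iter_euler_root (R : comNzRingType) (z : R) (s : nat) (u : {poly R}) :
  (iter s (@euler R) (('X - z%:P) ^+ s * u)).[z] = s`!%:R * z ^+ s * u.[z].
Proof.
elim: s u => [|s IHs] u; first by rewrite !mul1r.
rewrite iterSr.
have ->: euler (('X - z%:P) ^+ s.+1 * u) =
    ('X - z%:P) ^+ s * ('X * (u *+ s.+1 + ('X - z%:P) * u^`())).
  by rewrite /euler derivM deriv_exp derivXsubC mul1r /= exprS; ring.
rewrite IHs hornerM hornerX hornerD hornerMn hornerM hornerXsubC subrr mul0r.
rewrite factS natrM exprS. ring.
Qed.

Lemma iter_euler_multiple_root (R : comNzRingType) (z : R) (s m : nat)
    (u : {poly R}) : (s < m)%N ->
  (iter s (@euler R) (('X - z%:P) ^+ m * u)).[z] = 0.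
Proof.
move=> lt_sm; rewrite -(subnKC lt_sm) addSnnS exprD -mulrA iter_euler_root.
by rewrite exprS !hornerM hornerXsubC subrr !mul0r mulr0.
Qed.

(** * The functional sending powers of the variable to an exponential sum *)

Section Functional.

Variables (R : comNzRingType) (n : nat) (m : 'I_n -> nat).
Variables (c : 'I_n -> nat -> R) (z : 'I_n -> R).

(** The functional q |-> sum_k q_k g(k) for the exponential sum g, in the form
    that makes it a combination of evaluations at the nodes; [umbral_Xn] relates
    the two. *)
Definition umbral (q : {poly R}) : R :=
  \sum_(j < n) \sum_(s < m j) c j s * (iter s (@euler R) q).[z j].

Lemma umbral_is_scalar : scalar umbral.
Proof.
move=> a p q; rewrite /umbral mulr_sumr -big_split; apply: eq_bigr => j _ /=.
rewrite mulr_sumr -big_split; apply: eq_bigr => s _ /=.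
by rewrite iter_euler_is_linear hornerD hornerZ mulrDr mulrCA.
Qed.

HB.instance Definition _ :=
  GRing.isLinear.Build R {poly R} R *%R umbral umbral_is_scalar.

Lemma umbral_Xn (k : nat) : umbral 'X^k = monomial_exp_sum m c z k.
Proof.
apply: eq_bigr => j _; apply: eq_bigr => s _.
by rewrite iter_euler_Xn hornerZ hornerXn mulrA.
Qed.

Lemma umbral_mulX (k : nat) (q : {poly R}) (d : nat) : (size q <= d)%N ->
  umbral ('X^k * q) = \sum_(i < d) q`_i * monomial_exp_sum m c z (k + i).
Proof.
move=> le_q_d; rewrite -[q in LHS](coefK q) poly_def.
rewrite mulr_sumr linear_sum /= (big_ord_widen d (fun i =>
  umbral ('X^k * (q`_i *: 'X^i))) le_q_d) big_mkcond /=.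
apply: eq_bigr => i _; case: ltnP => [_ | /(nth_default 0)->]; last first.
  by rewrite mul0r.
by rewrite -scalerAr linearZ /= -exprD umbral_Xn.
Qed.

Lemma prony_polyD1 (j : 'I_n) : prony_poly m z =
  ('X - (z j)%:P) ^+ m j * \prod_(i < n | i != j) ('X - (z i)%:P) ^+ m i.
Proof. by rewrite /prony_poly (bigD1 j). Qed.

(** The node z_j is a root of P of order m_j, whereas L applies fewer than m_j
    Euler operators there. *)
Lemma umbral_prony (q : {poly R}) : umbral (prony_poly m z * q) = 0.
Proof.
apply: big1 => j _; apply: big1 => s _.
by rewrite (prony_polyD1 j) -mulrA iter_euler_multiple_root ?mulr0.
Qed.

(** The polynomial on the left is P / (X - z_j) times q: lowering the order at
    z_j by one lets exactly one term of the functional survive, the one with the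
    leading coefficient at z_j. *)
Lemma umbral_prony_quotient (j : 'I_n) (q : {poly R}) : (0 < m j)%N ->
  umbral (('X - (z j)%:P) ^+ (m j).-1 *
      (\prod_(i < n | i != j) ('X - (z i)%:P) ^+ m i * q)) =
  c j (m j).-1 * ((m j).-1`!%:R * z j ^+ (m j).-1 *
    (\prod_(i < n | i != j) (z j - z i) ^+ m i * q.[z j])).
Proof.
move=> m_gt0; rewrite /umbral (bigD1 j) //= [X in _ + X]big1 => [|i neq_ij].
  rewrite addr0; case: (m j) m_gt0 => // k _ /=; rewrite big_ord_recr /=.
  rewrite big1 ?add0r => [|s _]; last by rewrite iter_euler_multiple_root ?mulr0.
  rewrite iter_euler_root hornerM horner_prod; congr (_ * (_ * (_ * _))).
  by apply: eq_bigr => i _; rewrite horner_exp hornerXsubC.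
apply: big1 => s _; rewrite (bigD1 i) //= -mulrA mulrCA.
by rewrite iter_euler_multiple_root ?mulr0.
Qed.

Lemma monic_prony : prony_poly m z \is monic.
Proof. by apply: monic_prod => j _; rewrite monic_exp ?monicXsubC. Qed.

Lemma size_prony : size (prony_poly m z) = (\sum_(j < n) m j).+1.
Proof.
suff [] : prony_poly m z \is monic /\
    size (prony_poly m z) = (\sum_(j < n) m j).+1 by [].
rewrite /prony_poly; elim/big_ind2: _ => [|p M1 q M2 [mp sp] [mq sq]|j _].
- by rewrite size_poly1 monic1.
- by rewrite monicMr // size_monicM ?monic_neq0 // sp sq addSn addnS.
- by rewrite monic_exp ?monicXsubC // size_exp_XsubC.
Qed.
End Functional.

(** * Rank of the Hankel matrix *)

Section Hankel.

Variables (F : fieldType) (n : nat) (m : 'I_n -> nat).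
Variables (c : 'I_n -> nat -> F) (z : 'I_n -> F).

Let g := monomial_exp_sum m c z.
Let P := prony_poly m z.
Let M := (\sum_(j < n) m j)%N.

(** This turns the left kernel of the Hankel matrix into a condition on the
    polynomial whose coefficients form the vector. *)
Lemma mul_hankel_mx (k N : nat) (v : 'rV_N) (l : 'I_N) :
  (v *m hankel_mx g k N) 0 l = umbral m c z ('X^(k + l) * rVpoly v).
Proof.
rewrite (umbral_mulX _ _ _ _ (size_poly _ _)) mxE; apply: eq_bigr => i _.
by rewrite mxE coef_rVpoly_ord addnAC.
Qed.

(** A polynomial that is not a multiple of P has order a < m_j at some z_j;
    multiplying it by P / (X - z_j)^(a + 1) yields a value of the functional
    that [umbral_prony_quotient] shows to be nonzero. The multiplier has degree
    less than M, so M consecutive shifts of the variable suffice. *)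
Lemma dvdp_prony (k : nat) (q : {poly F}) :
  [pchar F] =i pred0 -> injective z -> (forall j, z j != 0) ->
  (forall j, 0 < m j)%N -> (forall j, c j (m j).-1 != 0) ->
  (forall l, (l < M)%N -> umbral m c z ('X^(k + l) * q) = 0) -> P %| q.
Proof.
move=> charF0 inj_z z_neq0 m_gt0 c_neq0 Lq0.
have Lrq0 (r : {poly F}) : (size r <= M)%N -> umbral m c z ('X^k * (r * q)) = 0.
  move=> le_r_M; rewrite -[r]coefK poly_def mulr_suml mulr_sumr linear_sum.
  apply: big1 => l _; rewrite -scalerAl -scalerAr linearZ /= mulrA -exprD.
  by rewrite Lq0 ?mulr0 // (leq_trans (ltn_ord l)).
apply: dvdp_prod_coprime => [i j neq_ij | j].
  apply/coprimep_expl/coprimep_expr/coprimep_XsubC2.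
  by rewrite subr_eq0 eq_sym (inj_eq inj_z).
have [a [u u_nz Dq]] := multiplicity_XsubC q (z j).
rewrite Dq; have [le_ma | lt_am] := leqP (m j) a.
  by rewrite dvdp_mull ?dvdp_exp2l.
have [q0 | q_neq0] := eqVneq q 0; first by rewrite -Dq q0 dvdp0.
have {u_nz} uz_neq0 : u.[z j] != 0 by move: u_nz; rewrite q_neq0.
set Q := \prod_(i < n | i != j) ('X - (z i)%:P) ^+ m i.
(* r is P / (X - z_j)^(a + 1). *)
pose r := Q * ('X - (z j)%:P) ^+ ((m j).-1 - a).
have le_r_M : (size r <= M)%N.
  have := size_prony m z; rewrite (prony_polyD1 _ _ j) -/Q => sizeP.
  have mQ : Q \is monic by apply: monic_prod => i _; rewrite monic_exp ?monicXsubC.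
  have mX e : ('X - (z j)%:P) ^+ e \is monic by rewrite monic_exp ?monicXsubC.
  move: sizeP; rewrite /r !size_monicM ?monic_neq0 // !size_exp_XsubC -/M.
  have := m_gt0 j; have : (0 < size Q)%N by rewrite size_poly_gt0 monic_neq0.
  move: lt_am; clear; move: (m j) M (size Q); lia.
have := Lrq0 r le_r_M; rewrite Dq.
have -> : 'X^k * (r * (u * ('X - (z j)%:P) ^+ a)) =
    ('X - (z j)%:P) ^+ (m j).-1 * (Q * ('X^k * u)).
  have le_am : (a <= (m j).-1)%N by rewrite -ltnS prednK.
  by rewrite -[in RHS](subnK le_am) exprD /r; ring.
(* Each factor of the value is nonzero: the factorial in characteristic 0, the
   differences of nodes by injectivity of z. *)
rewrite umbral_prony_quotient // => /eqP; rewrite !mulf_eq0 hornerM hornerXn.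
rewrite mulf_eq0 (negPf (c_neq0 j)) (negPf uz_neq0) !expf_eq0 (negPf (z_neq0 j)).
rewrite !andbF !orbF /= ((pcharf0P F).1 charF0) (gtn_eqF (fact_gt0 _)) /=.
case/prodf_eq0 => i neq_ij; rewrite expf_eq0 subr_eq0 (inj_eq inj_z).
by rewrite eq_sym (negPf neq_ij) andbF.
Qed.

(** The left kernel of the Hankel matrix is that of reduction modulo P, which is
    onto the polynomials of degree less than M because these reduce to
    themselves and M <= N. *)
Lemma rank_hankel_mx (k N : nat) :
  [pchar F] =i pred0 -> injective z -> (forall j, z j != 0) ->
  (forall j, 0 < m j)%N -> (forall j, c j (m j).-1 != 0) -> (M <= N)%N ->
  \rank (hankel_mx g k N) = M.
Proof.
move=> charF0 inj_z z_neq0 m_gt0 c_neq0 leMN.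
have P_neq0 : P != 0 by rewrite monic_neq0 ?monic_prony.
pose red (v : 'rV[F]_N) : 'rV_M := poly_rV (rVpoly v %% P).
have red_linear : linear red.
  by move=> a u v; rewrite /red linearP modpD modpZl linearP.
pose A := lin1_mx (HB.pack_for {linear 'rV_N -> 'rV_M} red
  (GRing.isLinear.Build F 'rV[F]_N 'rV[F]_M *:%R red red_linear)).
have mulA v : v *m A = red v by rewrite mul_rV_lin1.
have rVpoly_mulA v : rVpoly (v *m A) = rVpoly v %% P.
  by rewrite mulA poly_rV_K // -ltnS -(size_prony m z) ltn_modp.
have fullA : row_full A.
  apply/row_fullP; exists (lin1_mx (poly_rV \o rVpoly)).
  apply/row_matrixP=> i; rewrite !rowE mulmx1 mulmxA mulA mul_rV_lin1.
  rewrite /red /= poly_rV_K; last exact: leq_trans (size_poly _ _) leMN.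
  by rewrite modp_small ?rVpolyK // size_prony ltnS size_poly.
rewrite -[RHS](eqP fullA); apply: eq_mxrank_ker => v; split=> [vH0 | vA0].
  have dvd_v : P %| rVpoly v.
    apply: (@dvdp_prony k) => // l lt_lM.
    by rewrite -(mul_hankel_mx k v (Ordinal (leq_trans lt_lM leMN))) vH0 mxE.
  by rewrite mulA /red (eqP dvd_v) linear0.
apply/rowP=> l; rewrite mul_hankel_mx mxE.
have /dvdpP[q ->] : P %| rVpoly v.
  by rewrite /dvdp -rVpoly_mulA vA0 linear0.
by rewrite mulrCA mulrA mulrC umbral_prony.
Qed.

End Hankel.

(** * The companion identity *)

(** All columns of the companion matrix but the last shift the Hankel columns by
    one; the last one expresses g(k + i + M) by the recurrence that the
    functional yields on 'X^(k + i) * P. *)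
Lemma hankel_cols_companion (R : comNzRingType) (n : nat) (m : 'I_n -> nat)
    (c : 'I_n -> nat -> R) (z : 'I_n -> R) (M k N : nat) (leMN : (M <= N)%N)
    (g := monomial_exp_sum m c z) : M = (\sum_(j < n) m j)%N ->
  hankel_cols g k.+1 leMN =
    hankel_cols g k leMN *m companion_mx M (prony_poly m z).
Proof.
move=> defM; apply/matrixP=> i l; rewrite !mxE /=.
under eq_bigr => s _ do rewrite !mxE /=.
have [lM | l'M] := eqVneq l.+1 M; last first.
  have lt_lM : (l.+1 < M)%N by rewrite ltn_neqAle l'M ltn_ord.
  rewrite (bigD1 (Ordinal lt_lM)) //= eqxx mulr1 big1 => [|s neq_sl].
    by rewrite addr0; congr g; lia.
  suff /negPf-> : nat_of_ord s != l.+1 by rewrite mulr0.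
  by apply: contraNneq neq_sl => eq_sl; apply/eqP/val_inj.
have sizeP : size (prony_poly m z) = M.+1 by rewrite size_prony defM.
have := umbral_prony m c z 'X^(k + i).
rewrite mulrC (umbral_mulX _ _ _ _ (eq_leq sizeP)) big_ord_recr /=.
have := monic_prony m z; rewrite monicE lead_coefE sizeP /= => /eqP->.
rewrite mul1r => /eqP; rewrite addrC addr_eq0 => /eqP; rewrite -/g => gM.
transitivity (g (k + i + M)%N); first by congr g; lia.
rewrite gM -sumrN; apply: eq_bigr => s _; rewrite mulrN.
by congr (- _); rewrite mulrC.
Qed.

(** * Application to the sampled data *)

Lemma cexp_neq0 (R : realType) (w : R[i]) : cexp w != 0.
Proof.
rewrite /cexp eq_complex /= !mulf_eq0 !(gt_eqF (expR_gt0 _)) /=.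
apply/andP=> -[/eqP cos0 /eqP sin0].
have := cos2Dsin2 (complex.Im w); rewrite cos0 sin0 expr0n addr0.
by move/eqP; rewrite eq_sym oner_eq0.
Qed.

Lemma eq_hankel_mx (T : Type) (g h : nat -> T) (k N : nat) :
  (forall i, (k <= i < k + (2 * N).-1)%N -> g i = h i) ->
  hankel_mx g k N = hankel_mx h k N.
Proof.
move=> eq_gh; apply/matrixP=> i l; rewrite !mxE; apply: eq_gh.
by move: (ltn_ord i) (ltn_ord l); lia.
Qed.

Theorem lemma2p1 (R : realType) (n : nat) (m : 'I_n -> nat) (M : nat)
    (n_gt0 : (0 < n)%N) (m_gt0 : forall j, (0 < m j)%N)
    (defM : M = (\sum_(j < n) m j)%N)
    (f : 'I_n -> R[i]) (c : 'I_n -> nat -> R[i]) (z : 'I_n -> R[i])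
    (f_neq0 : forall j, f j != 0)
    (defz : forall j, z j = cexp (f j))
    (k0 N : nat) (leMN : (M <= N)%N)
    (* the 2N sampled values; only the sampling window is constrained *)
    (h : nat -> R[i])
    (noiseless : forall k, (k0 <= k < k0 + 2 * N)%N ->
       h k = monomial_exp_sum m c z k) :
  (* (a), for distinct z_j and nonvanishing leading coefficients, i.e. when the
     order of the sum is really M *)
  (injective z -> (forall j, c j (m j).-1 != 0) ->
     \rank (hankel_mx h k0 N) = M /\ \rank (hankel_mx h k0.+1 N) = M) /\
  (* (b) *)
  hankel_cols h k0.+1 leMN =
    hankel_cols h k0 leMN *m companion_mx M (prony_poly m z).
Proof.
have eqH0 : hankel_mx h k0 N = hankel_mx (monomial_exp_sum m c z) k0 N.
  by apply: eq_hankel_mx => i lt_i; apply: noiseless; lia.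
have eqH1 : hankel_mx h k0.+1 N = hankel_mx (monomial_exp_sum m c z) k0.+1 N.
  by apply: eq_hankel_mx => i lt_i; apply: noiseless; lia.
split; last by rewrite /hankel_cols eqH0 eqH1; apply: hankel_cols_companion.
move=> inj_z c_neq0; rewrite eqH0 eqH1 !rank_hankel_mx -?defM //.
- exact: pchar_num.
- by move=> j; rewrite defz cexp_neq0.
- exact: pchar_num.
- by move=> j; rewrite defz cexp_neq0.
Qed.
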